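(* Let $s,t\geq 1$ be integers and let $p,q,l$ be three distinct primes with $p,q$ odd, $p\equiv 3 \pmod 4$, $\mathrm{ord}_{p^s}(l)=\phi(p^s)/2$, $\mathrm{ord}_{q^t}(l)=\phi(q^t)$ and $\gcd(\phi(p^s),\phi(q^t))=2$. Let $0\leq i<i'\leq s-1$ and $0\leq j<j'\leq t$. Then in the ring $\mathbb{F}_l[x]/\langle x^{p^sq^t}-1\rangle$: (i) $\chi_{ij}\chi_{i'j'}=\chi_{ij}\chi_{i'j'}^*=\frac{\phi(p^{s-i'})}{2}\phi(q^{t-j'})\chi_{ij}$. (ii) $\chi_{ij}^*\chi_{i'j'}=\chi_{ij}^*\chi_{i'j'}^*=\frac{\phi(p^{s-i'})}{2}\phi(q^{t-j'})\chi_{ij}^*$.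
   Context: Here $\phi$ is Euler's phi function (with $\phi(1)=1$) and $\mathrm{ord}_m(k)$ is the multiplicative order of $k$ modulo $m$. Put $n=p^sq^t$. Fix an integer $g$ that is a primitive root both modulo $p^s$ and modulo $q^t$. For an integer $\gamma$, $C_\gamma=\{\gamma l^r \bmod n: r\geq 0\}\subseteq \mathbb{Z}_n$ is the $l$-cyclotomic coset modulo $n$ containing $\gamma$. For $0\leq i\leq s$, $0\leq j\leq t$ set $C_{ij}=C_{p^iq^j}$ and $C_{ij}^*=C_{p^iq^jg}$. Define elements of $\mathbb{F}_l[x]/\langle x^{n}-1\rangle$ by $\chi_{ij}=\sum_{\alpha\in C_{ij}}x^\alpha$ and $\chi_{ij}^*=\sum_{\alpha\in C_{ij}^*}x^\alpha$. Integer coefficients are read in $\mathbb{F}_l$. *)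

(* Defs.v *)
From mathcomp Require Import all_boot all_order all_algebra.
From mathcomp Require Import cyclic boolp.

Set Implicit Arguments.
Unset Strict Implicit.
Unset Printing Implicit Defensive.

Import Order.TTheory GRing.Theory Num.Theory.

Local Open Scope ring_scope.

(* By Euler's theorem the least exponent is at most totient m, so the search
   over 'I_(totient m).+1 is exhaustive (see mulordP).  The value is 0 when k
   is not a unit modulo m. *)
Definition mulord (m : nat) (k : int) : nat :=
  if coprimez m k then
    nat_of_ord [arg min_(d < (ord_max : 'I_(totient m).+1)
        | (0 < d)%N && (k ^+ d == 1 %[mod m])%Z) d]
  else 0%N.

Lemma Euler_totient_int (m : nat) (k : int) :
  coprimez m k -> (k ^+ totient m = 1 %[mod m])%Z.
Proof.
case: m => [|m] co_mk; first by rewrite expr0.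
have := modz_ge0 k (isT : (m.+1 : int) != 0).
case E: (k %% m.+1)%Z => [a|//] _.
rewrite -modzXm E -[Posz a ^+ _]rmorphXn /= !modz_nat.
congr Posz; apply: Euler_exp_totient.
by rewrite /coprime gcdnC -[gcdn _ _]/`|gcdz m.+1 a|%N -E gcdz_modr.
Qed.

Lemma mulordP (m : nat) (k : int) : (0 < m)%N -> coprimez m k ->
  [/\ (0 < mulord m k)%N, (k ^+ mulord m k = 1 %[mod m])%Z &
      forall d : nat, (0 < d)%N -> (k ^+ d = 1 %[mod m])%Z ->
        (mulord m k <= d)%N].
Proof.
move=> m_gt0 co_mk; rewrite /mulord co_mk; case: arg_minnP => [|d0].
  by rewrite /= totient_gt0 m_gt0; apply/eqP/Euler_totient_int.
move=> /andP[d0_gt0 /eqP kd0] min_d0; split=> // d d_gt0 kd.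
have [le_d|lt_d] := leqP d (totient m).
  by apply: (min_d0 (Ordinal (le_d : (d < (totient m).+1)%N))); rewrite d_gt0 kd /=.
by apply: ltnW; apply: leq_ltn_trans lt_d; rewrite -ltnS.
Qed.

Definition primitive_root_mod (m : nat) (g : int) : Prop :=
  mulord m g = totient m.

Definition cyclotomic_coset (l n : nat) (gamma : int) : {set 'I_n} :=
  [set a : 'I_n | `[< exists r : nat,
      (a : int) = (gamma * (l : int) ^+ r %% (n : int))%Z >]].

(* For n > 0 the polynomial 'X^n - 1 is monic of positive degree, so
   {poly %/ 'X^n - 1} really is the quotient by it (see mk_monic_Xn_sub1). *)
Notation cyc_ring l n := {poly %/ ('X^n - 1 : {poly 'F_l})}.

Lemma mk_monic_Xn_sub1 (l n : nat) : (0 < n)%N ->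
  mk_monic ('X^n - 1 : {poly 'F_l}) = 'X^n - 1.
Proof.
move=> n_gt0; rewrite /mk_monic -[1]/(1%:P) size_XnsubC // ltnS n_gt0.
by rewrite monicXnsubC.
Qed.

Definition coset_sum (l n : nat) (C : {set 'I_n}) : cyc_ring l n :=
  \sum_(a in C) in_qpoly ('X^n - 1) 'X^a.

Definition chi (p q l s t i j : nat) : cyc_ring l (p ^ s * q ^ t) :=
  coset_sum l (cyclotomic_coset l (p ^ s * q ^ t) (p ^ i * q ^ j)%N).

Definition chi_star (g : int) (p q l s t i j : nat) :
    cyc_ring l (p ^ s * q ^ t) :=
  coset_sum l (cyclotomic_coset l (p ^ s * q ^ t) ((p ^ i * q ^ j)%N%:Z * g)).

(* Main.v *)
(* Since [p = 3 mod 4] and the gcd of the two totients is 2, the order of [l]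
   modulo [n = p^s q^t] is half of [totient n], so the powers of [l] form a
   subgroup of index 2 of the unit group.  A residue [y = 1 mod pq] has odd
   order modulo [n], hence is a power of [l].  Consequently
   [p^i q^j u + p^i' q^j' v], which is [p^i q^j u y] for such a [y] when
   [i < i'] and [j < j'], stays in the coset of [p^i q^j u]: translation by an
   element of the second coset permutes the first one, and the product of the
   two coset sums is the first one times the cardinal of the second coset.
   That cardinal is the order of [l] modulo [p^(s-i') q^(t-j')]. *)

Require Import Defs.
From mathcomp Require Import all_boot all_order all_algebra.
From mathcomp Require Import all_fingroup cyclic boolp zify.

Set Implicit Arguments.
Unset Strict Implicit.
Unset Printing Implicit Defensive.

Import GRing.Theory.

Local Open Scope ring_scope.

(** Each [p]-th power gains one factor [p]: in [y ^ p - 1 = (y - 1) * \sum_k y ^ k] the sum has [p]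
    terms, all congruent to 1 modulo [p]. *)
Lemma expn_mod1_pfactor p a c x : prime p -> (0 < a)%N ->
  (x = 1 %[mod p ^ a] -> x ^ (p ^ c) = 1 %[mod p ^ (a + c)])%N.
Proof.
move=> p_pr a_gt0 x1; elim: c => [|c IH]; first by rewrite addn0.
have p_gt1 := prime_gt1 p_pr; have pa_gt1 : (1 < p ^ a)%N by rewrite -(exp1n a) ltn_exp2r.
have x_gt0 : (0 < x)%N.
  by case: x x1 {IH} => [|//]; rewrite mod0n modn_small.
rewrite addnS !expnSr expnM; set y := (x ^ p ^ c)%N in IH *.
have y_gt0 : (0 < y)%N by rewrite expn_gt0 x_gt0.
have yp : (y = 1 %[mod p])%N.
  have dp : (p %| p ^ (a + c))%N by rewrite dvdn_exp // addn_gt0 a_gt0.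
  by rewrite -(modn_dvdm y dp) IH modn_dvdm.
have yp_gt0 : (0 < y ^ p)%N by rewrite expn_gt0 y_gt0.
apply/eqP; rewrite eqn_mod_dvd // subn1 predn_exp.
apply: dvdn_mul; first by rewrite -subn1 -eqn_mod_dvd //; apply/eqP.
rewrite /dvdn -modn_summ (eq_bigr (fun=> 1 %% p)%N) => [|k _].
  by rewrite modn_summ sum_nat_const card_ord muln1 modnn.
by rewrite -modnXm yp modnXm exp1n.
Qed.

(** * Multiplicative orders of natural numbers *)

Lemma eqz_modn (m a b : nat) :
  ((a : int) = b %[mod m])%Z <-> (a = b %[mod m])%N.
Proof. by rewrite !modz_nat; split=> [[]|->]. Qed.

Lemma mulord_nat_minP (m k : nat) : (0 < m)%N -> coprime m k ->
  [/\ (0 < mulord m k)%N, (k ^ mulord m k = 1 %[mod m])%N &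
      forall d : nat, (0 < d)%N -> (k ^ d = 1 %[mod m])%N ->
        (mulord m k <= d)%N].
Proof.
move=> m_gt0 co_mk; have co : coprimez m k by rewrite coprimezE.
have [e_gt0 ke min_e] := mulordP m_gt0 co.
have E d : ((k : int) ^+ d = 1 %[mod m])%Z <-> (k ^ d = 1 %[mod m])%N.
  by rewrite -[Posz k ^+ _]rmorphXn natrXE; apply: eqz_modn.
by split=> // [|d d_gt0 /E]; [apply/E|apply: min_e].
Qed.

Lemma mulord_dvdn (m k d : nat) : (0 < m)%N -> coprime m k ->
  (mulord m k %| d)%N <-> (k ^ d = 1 %[mod m])%N.
Proof.
move=> m_gt0 co_mk; have [e_gt0 ke min_e] := mulord_nat_minP m_gt0 co_mk.
set e := mulord m k in e_gt0 ke min_e *.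
have kme c : (k ^ (c * e) = 1 %[mod m])%N.
  by rewrite mulnC expnM -modnXm ke modnXm exp1n.
split=> [/dvdnP[c ->] // | kd].
rewrite /dvdn; case: (posnP (d %% e)) => [//|r_gt0].
have /(min_e _ r_gt0) : (k ^ (d %% e) = 1 %[mod m])%N.
  rewrite -[(k ^ _)%N]mul1n -modnMml -(kme (d %/ e)%N) modnMml -expnD.
  by rewrite -divn_eq kd.
by rewrite leqNgt ltn_mod e_gt0.
Qed.

(** * Residues as elements of the unit group of ['Z_n] *)

Lemma unit_Zp_of_coprime (n x : nat) : (1 < n)%N -> coprime n x ->
  exists u : {unit 'Z_n}, FinRing.uval u = x%:R.
Proof.
move=> n1 co; have Ux := co; rewrite -unitZpE // in Ux.
by exists (FinRing.unit 'Z_n Ux).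
Qed.

Lemma eq_Zp_nat (n x y : nat) : (1 < n)%N ->
  x%:R = y%:R :> 'Z_n <-> (x = y %[mod n])%N.
Proof.
by move=> n1; split=> [/(congr1 val)|E]; [|apply: val_inj];
  rewrite /= !val_Zp_nat.
Qed.

Lemma eq_unit_Zp_exp (n x y : nat) (u v : {unit 'Z_n}) a b : (1 < n)%N ->
  FinRing.uval u = x%:R -> FinRing.uval v = y%:R ->
  (u ^+ a = v ^+ b)%g <-> (x ^ a = y ^ b %[mod n])%N.
Proof.
move=> n1 ux vy; rewrite -eq_Zp_nat // !natrX -ux -vy -!FinRing.val_unitX.
by split=> [->|/val_inj].
Qed.

Lemma order_unit_Zp (n x : nat) (u : {unit 'Z_n}) : (1 < n)%N ->
  coprime n x -> FinRing.uval u = x%:R -> #[u]%g = mulord n x.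
Proof.
move=> n1 co ux; have n0 := ltnW n1.
have E d : (#[u]%g %| d)%N <-> (mulord n x %| d)%N.
  rewrite order_dvdn mulord_dvdn // -[X in (_ = X %[mod n])%N](exp1n d).
  rewrite -(@eq_unit_Zp_exp n x 1 u 1%g d d) //.
  by rewrite expg1n; split=> [/eqP|->].
by apply/eqP; rewrite eqn_dvd; apply/andP; split; [apply/E|apply/E].
Qed.

(* The powers of [k] form a subgroup of index 2 of the unit group, and an
   element of odd order has trivial image in the quotient of order 2. *)
Lemma odd_order_mem_powers (n k y M : nat) : (1 < n)%N -> coprime n k ->
  coprime n y -> totient n = (mulord n k * 2)%N -> odd M ->
  (y ^ M = 1 %[mod n])%N -> exists r, (y = k ^ r %[mod n])%N.
Proof.
move=> n1 cok coy tn oddM yM.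
have [u uk] := unit_Zp_of_coprime n1 cok.
have [v vy] := unit_Zp_of_coprime n1 coy.
have sub : <[u]>%g \subset units_Zp n by apply: subsetT.
have idx : #|units_Zp n : <[u]>|%g = 2%N.
  rewrite -divgS // card_units_Zp ?(ltnW n1) //.
  have := order_unit_Zp n1 cok uk; rewrite /order tn => ->.
  by have [e_gt0 _ _] := mulord_nat_minP (ltnW n1) cok; rewrite mulKn.
have nor := index2_normal sub idx.
have vN : v \in 'N(<[u]>)%g by apply: (subsetP (normal_norm nor)); rewrite inE.
have : coset <[u]> v = 1%g.
  apply/eqP; rewrite -order_eq1 -dvdn1.
  have /eqP <- : coprime 2 M by rewrite coprime2n.
  rewrite dvdn_gcd; apply/andP; split.
    rewrite -idx -card_quotient ?normal_norm //; apply: order_dvdG.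
    by apply: mem_quotient; rewrite inE.
  rewrite order_dvdn -morphX //.
  have -> : (v ^+ M = 1)%g.
    by rewrite -(expg1 1%g); apply/(@eq_unit_Zp_exp n y 1).
  by rewrite morph1.
move/(coset_idr vN)/cycleP=> [r vr]; exists r.
by rewrite -[y]expn1; apply/(@eq_unit_Zp_exp n y k v u 1 r n1 vy uk).
Qed.

(** * Orders modulo products and prime powers *)

(** By the Chinese remainder theorem the order modulo the product is the lcm of the two orders,
    which are coprime here. *)
Lemma mulordM (m1 m2 k : nat) : (0 < m1)%N -> (0 < m2)%N ->
  coprime m1 m2 -> coprime m1 k -> coprime m2 k ->
  coprime (mulord m1 k) (mulord m2 k) ->
  mulord (m1 * m2) k = (mulord m1 k * mulord m2 k)%N.
Proof.
move=> m1_gt0 m2_gt0 co12 co1 co2 co_ord.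
have m_gt0 : (0 < m1 * m2)%N by rewrite muln_gt0 m1_gt0.
have co : coprime (m1 * m2) k by rewrite coprimeMl co1.
have E d : (mulord (m1 * m2) k %| d)%N <-> (mulord m1 k * mulord m2 k %| d)%N.
  rewrite Gauss_dvd // mulord_dvdn //.
  split=> [/eqP|/andP[/mulord_dvdn e1 /mulord_dvdn e2]].
    by rewrite chinese_remainder // => /andP[/eqP/mulord_dvdn-> // /eqP/mulord_dvdn->].
  by apply/eqP; rewrite chinese_remainder // e1 // e2 // !eqxx.
by apply/eqP; rewrite eqn_dvd; apply/andP; split; [apply/E|apply/E].
Qed.

(** A power of [k] that is 1 modulo [p ^ a] becomes 1 modulo [p ^ s] once raised to [p ^ (s - a)];
    this factor then cancels from the divisibility of orders. In the applications [h] is [p - 1] or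
    half of it. *)
Lemma dvdn_mulord_pfactor (p k s a h : nat) : prime p -> coprime p k ->
  (0 < a <= s)%N -> mulord (p ^ s) k = (h * p ^ s.-1)%N ->
  (h * p ^ a.-1 %| mulord (p ^ a) k)%N.
Proof.
move=> p_pr co /andP[a_gt0 le_as] ord_s; have p_gt0 := prime_gt0 p_pr.
have pX_gt0 c : (0 < p ^ c)%N by rewrite expn_gt0 p_gt0.
have coX c : coprime (p ^ c) k by rewrite coprimeXl.
have : (mulord (p ^ s) k %| mulord (p ^ a) k * p ^ (s - a))%N.
  apply/mulord_dvdn => //; rewrite expnM.
  rewrite -[in (p ^ s)%N](subnKC le_as); apply: expn_mod1_pfactor => //.
  exact/mulord_dvdn.
rewrite ord_s; have -> : s.-1 = (a.-1 + (s - a))%N by lia.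
by rewrite expnD mulnA dvdn_pmul2r.
Qed.

Lemma mulord_dvdn_totient (m k : nat) : (0 < m)%N -> coprime m k ->
  (mulord m k %| totient m)%N.
Proof.
by move=> m_gt0 co; apply/mulord_dvdn/Euler_exp_totient => //; rewrite coprime_sym.
Qed.

Lemma mulord_pfactor_totient (p k s a : nat) : prime p -> coprime p k ->
  (a <= s)%N -> mulord (p ^ s) k = totient (p ^ s) ->
  mulord (p ^ a) k = totient (p ^ a).
Proof.
move=> p_pr co le_as ord_s; have pX_gt0 : (0 < p ^ a)%N by rewrite expn_gt0 prime_gt0.
have coX : coprime (p ^ a) k by rewrite coprimeXl.
have dv := mulord_dvdn_totient pX_gt0 coX.
(* The lifting argument needs [a > 0]; modulus 1 has totient 1 and occurs in the theorem when
   [j' = t]. *)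
case: a => [|a] in le_as pX_gt0 coX dv *.
  by apply/eqP; move: dv; rewrite expn0 dvdn1.
apply/eqP; rewrite eqn_dvd dv /= totient_pfactor //.
apply: (@dvdn_mulord_pfactor p k s a.+1) => //.
by rewrite ord_s totient_pfactor //; lia.
Qed.

(* The order modulo [p ^ a] divides [2 * (h * p ^ a.-1)] by Euler and is odd,
   since it divides the odd order modulo [p ^ s]. *)
Lemma mulord_pfactor_half (p k s a : nat) : prime p -> coprime p k ->
  (0 < a <= s)%N -> (p = 3 %[mod 4])%N ->
  mulord (p ^ s) k = (totient (p ^ s) %/ 2)%N ->
  mulord (p ^ a) k = (totient (p ^ a) %/ 2)%N.
Proof.
move=> p_pr co le_as p3 ord_s; have p_gt0 := prime_gt0 p_pr.
have pX_gt0 c : (0 < p ^ c)%N by rewrite expn_gt0 p_gt0.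
have coX c : coprime (p ^ c) k by rewrite coprimeXl.
have [h [odd_h ph]] : exists h, odd h /\ p.-1 = (h * 2)%N.
  by exists (p.-1 %/ 2)%N; lia.
have tot c : (0 < c)%N -> totient (p ^ c) = (h * p ^ c.-1 * 2)%N.
  by move=> c_gt0; rewrite totient_pfactor // ph -mulnA [(2 * _)%N]mulnC mulnA.
have [a_gt0 le] := andP le_as.
rewrite tot // mulnK //; rewrite tot ?mulnK // in ord_s; last by lia.
apply/eqP; rewrite eqn_dvd (dvdn_mulord_pfactor _ _ le_as ord_s) // andbT.
have odd_s : odd (mulord (p ^ s) k).
  by rewrite ord_s oddM odd_h oddX orbC; apply/orP; left; lia.
have dv : (mulord (p ^ a) k %| mulord (p ^ s) k)%N.
  apply/mulord_dvdn => //.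
  have [_ /(congr1 (modn^~ (p ^ a)%N)) + _] := mulord_nat_minP (pX_gt0 s) (coX s).
  by rewrite !modn_dvdm // dvdn_exp2l.
rewrite -(@Gauss_dvdl _ _ 2) ?coprimen2 ?(dvdn_odd dv) //.
by rewrite -tot // mulord_dvdn_totient.
Qed.

(** * Size and translation of cyclotomic cosets *)

Lemma mem_cyclotomic_coset (l n c : nat) (a : 'I_n) :
  a \in cyclotomic_coset l n c <->
  exists r, (a = c * l ^ r %% n :> nat)%N.
Proof.
have E r : (c : int) * (l : int) ^+ r = (c * l ^ r)%N by rewrite -[Posz l ^+ r]rmorphXn natrXE PoszM.
rewrite inE; split=> [/asboolP[r H]|[r H]]; last apply/asboolP; exists r.
  by move: H; rewrite E modz_nat => -[].
by rewrite E modz_nat H.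
Qed.

Lemma cyclotomic_coset_modz (l n : nat) (c c' : int) : (c = c' %[mod n])%Z ->
  cyclotomic_coset l n c = cyclotomic_coset l n c'.
Proof.
move=> E; apply/setP=> a; rewrite !inE; apply: asbool_equiv_eq.
by split=> -[r ->]; exists r; rewrite -[LHS]modzMml -[RHS]modzMml E.
Qed.

Lemma coprime_modn_inv (m x : nat) : (0 < m)%N -> coprime m x ->
  exists w, (x * w = 1 %[mod m])%N.
Proof.
move=> m_gt0 co; exists (x ^ (totient m).-1)%N; rewrite -expnS prednK ?totient_gt0 //.
by apply: Euler_exp_totient; rewrite coprime_sym.
Qed.

Lemma coprime_modn_cancel (m x a b : nat) : (0 < m)%N -> coprime m x ->
  (x * a = x * b %[mod m])%N -> (a = b %[mod m])%N.
Proof.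
move=> m_gt0 co E; have [w xw] := coprime_modn_inv m_gt0 co.
rewrite -[a]mul1n -[b]mul1n -(modnMml 1) -[in RHS](modnMml 1) -xw !modnMml.
by rewrite !(mulnC x) -!mulnA -modnMmr E modnMmr.
Qed.

(** Since [d * v * l ^ r] modulo [d * m] is [d] times the residue of [v * l ^ r] modulo [m], only
    [r] modulo the order of [l] modulo [m] matters. *)
Lemma card_cyclotomic_coset (l n d m v : nat) : n = (d * m)%N ->
  (0 < d)%N -> (0 < m)%N -> coprime m l -> coprime m v ->
  #|cyclotomic_coset l n (d * v)%N| = mulord m l.
Proof.
move=> -> d_gt0 m_gt0 co_l co_v; have n_gt0 : (0 < d * m)%N by rewrite muln_gt0 d_gt0.
have [e_gt0 le min_e] := mulord_nat_minP m_gt0 co_l.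
pose f (r : 'I_(mulord m l)) := Ordinal (ltn_pmod (d * v * l ^ r) n_gt0).
have f_inj : injective f.
  suff inj_le (r r' : 'I_(mulord m l)) : (r <= r')%N -> f r = f r' -> r = r'.
    by move=> r r' E; case/orP: (leq_total r r') => le_r; [|symmetry]; apply: inj_le.
  move=> le_r /(congr1 val) /= /eqP; rewrite -!mulnA -!muln_modr.
  rewrite eqn_pmul2l // -(subnKC le_r) expnD mulnA -[in eqbLHS](muln1 (v * _)%N).
  move=> /eqP E; apply/val_inj => /=.
  (* Cancelling the unit [v * l ^ r] leaves [l ^ (r' - r) = 1] modulo [m], and minimality of the
     order forces [r' = r]. *)
  have co_vl : coprime m (v * l ^ r) by rewrite coprimeMr co_v coprimeXr.
  have dl1 : (l ^ (r' - r) = 1 %[mod m])%N.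
    exact/esym/(coprime_modn_cancel m_gt0 co_vl).
  apply/eqP; rewrite eqn_leq le_r -subn_eq0 /=; case: posnP => // dr_gt0.
  by have := min_e _ dr_gt0 dl1; have := ltn_ord r'; lia.
rewrite -[RHS]card_ord -(card_imset predT f_inj); apply: eq_card => a.
apply/idP/imsetP => [/mem_cyclotomic_coset[r aE]|[r _ ->]]; last first.
  by apply/mem_cyclotomic_coset; exists r.
exists (Ordinal (ltn_pmod r e_gt0)) => //; apply: val_inj; rewrite /= aE.
rewrite -!mulnA -!muln_modr; congr (_ * _)%N.
rewrite {1}(divn_eq r (mulord m l)) expnD mulnCA -modnMml.
have/(mulord_dvdn _ m_gt0 co_l) -> := dvdn_mull (r %/ mulord m l)%N (dvdnn (mulord m l)).
by rewrite modnMml mul1n.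
Qed.

Lemma cyclotomic_coset_translate (l n d e u v : nat) : (0 < n)%N ->
  coprime n l -> coprime n u ->
  (forall y, (y = 1 %[mod e])%N -> exists r, (y = l ^ r %[mod n])%N) ->
  forall a b c : 'I_n,
    a \in cyclotomic_coset l n (d * u)%N ->
    b \in cyclotomic_coset l n (e * d * v)%N ->
    (c = a + b %[mod n])%N -> c \in cyclotomic_coset l n (d * u)%N.
Proof.
move=> n_gt0 co_l co_u pow a b c /mem_cyclotomic_coset[r aE].
move=> /mem_cyclotomic_coset[k bE] cE; apply/mem_cyclotomic_coset.
set x := (u * l ^ r)%N.
have [w xw] : exists w, (x * w = 1 %[mod n])%N.
  by apply: coprime_modn_inv; rewrite // coprimeMr co_u coprimeXr.
(* Modulo [n], [a = d * x] and [a + b = d * x * y] with [y = 1 + e * w * v * l ^ k], where [w]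
   inverts [x]; as [y] is 1 modulo [e], it is a power of [l]. *)
have [|m yE] := pow (e * (w * v * l ^ k) + 1)%N; first by rewrite mulnC modnMDl.
exists (r + m)%N; rewrite -(modn_small (ltn_ord c)) cE aE bE modnDml modnDmr.
rewrite expnD mulnA -(modnMmr (_ * _)) -yE modnMmr mulnDr muln1.
rewrite addnC -[RHS]modnDml -[LHS]modnDml; congr ((_ + _) %% _)%N.
have -> : (d * u * l ^ r * (e * (w * v * l ^ k)) = e * d * v * l ^ k * (x * w))%N.
  by rewrite /x; lia.
by rewrite -[RHS]modnMmr xw modnMmr muln1.
Qed.

(** * Coset sums in the quotient ring *)

(** In the quotient ['X^n = 1]; positivity of [n] makes the modulus ['X^n - 1] itself rather than
    the default of [mk_monic]. *)
Lemma in_qpoly_Xn_modn (l n k : nat) : (0 < n)%N ->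
  in_qpoly ('X^n - 1 : {poly 'F_l}) 'X^(k %% n) = in_qpoly ('X^n - 1) 'X^k.
Proof.
move=> n_gt0; have Xn1 : in_qpoly ('X^n - 1 : {poly 'F_l}) 'X^n = 1.
  apply/eqP; rewrite -subr_eq0 -(in_qpoly1 ('X^n - 1)) -raddfB /=.
  apply/eqP/val_inj; rewrite /=. rewrite -{1}(@mk_monic_Xn_sub1 l n n_gt0).
  by rewrite Pdiv.RingMonic.rmodpp // monic_mk_monic.
rewrite {2}(divn_eq k n) mulnC exprD exprM in_qpolyM.
by rewrite [in_qpoly _ ('X^n ^+ _)]rmorphXn /= Xn1 expr1n mul1r.
Qed.

(** Translation by [b] is injective and maps the finite set [A] into itself, so it permutes [A]:
    multiplication by each ['X^b] fixes the sum over [A]. *)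
Lemma coset_sum_translate (l n : nat) (A B : {set 'I_n}) :
  (forall a b c : 'I_n, a \in A -> b \in B -> (c = a + b %[mod n])%N -> c \in A) ->
  coset_sum l A * coset_sum l B = (#|B|%:R : 'F_l) *: coset_sum l A.
Proof.
(* The empty case is set apart because [n > 0] is read off from an element of [A]. *)
have [->|[a0 _]] := set_0Vmem A; first by move=> _; rewrite /coset_sum big_set0 mul0r scaler0.
have n_gt0 : (0 < n)%N by apply: leq_ltn_trans (ltn_ord a0).
move=> stab; rewrite /coset_sum mulr_sumr scaler_nat -sumr_const.
apply: eq_bigr => b bB; rewrite mulr_suml.
pose f (a : 'I_n) := Ordinal (ltn_pmod (a + b) n_gt0).
have f_inj : injective f.
  move=> a a' /(congr1 val) /= /eqP; rewrite eqn_modDr !modn_small // => /eqP.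
  exact: val_inj.
have fA : f @: A = A.
  apply/eqP; rewrite eqEcard card_imset // leqnn andbT.
  apply/subsetP=> _ /imsetP[a aA ->]; apply: stab aA bB _.
  by rewrite /= modn_mod.
rewrite -[in RHS]fA big_imset /=; last by move=> ? ? _ _; apply: f_inj.
by apply: eq_bigr => a _; rewrite in_qpoly_Xn_modn // exprD in_qpolyM.
Qed.

(** The value 0 of [mulord] on non-units lets the primitive root hypotheses certify that [g] is a
    unit. *)
Lemma mulord_gt0_coprimez (m : nat) (k : int) : (0 < mulord m k)%N -> coprimez m k.
Proof. by rewrite /mulord; case: coprimez. Qed.

Theorem theorem4p6 (s t p q l : nat) (g : int)
  (hs : (1 <= s)%N) (ht : (1 <= t)%N)
  (hp : prime p) (hq : prime q) (hl : prime l)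
  (hpq : p <> q) (hpl : p <> l) (hql : q <> l)
  (p_odd : odd p) (q_odd : odd q)
  (hp4 : p = 3 %[mod 4])
  (hordp : mulord (p ^ s) l = (totient (p ^ s) %/ 2)%N)
  (hordq : mulord (q ^ t) l = totient (q ^ t))
  (hgcd : gcdn (totient (p ^ s)) (totient (q ^ t)) = 2%N)
  (hgp : primitive_root_mod (p ^ s) g)
  (hgq : primitive_root_mod (q ^ t) g)
  (i i' j j' : nat)
  (hii' : (i < i')%N) (hi' : (i' <= s - 1)%N)
  (hjj' : (j < j')%N) (hj' : (j' <= t)%N) :
  let c : 'F_l :=
    ((totient (p ^ (s - i')) %/ 2) * totient (q ^ (t - j')))%N%:R in
  let X := chi p q l s t in
  let X_star := chi_star g p q l s t in
  (X i j * X i' j' = c *: X i j /\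
   X i j * X_star i' j' = c *: X i j) /\
  (X_star i j * X i' j' = c *: X_star i j /\
   X_star i j * X_star i' j' = c *: X_star i j).
Proof.
move=> c X X_star.
have [p_gt1 q_gt1] := (prime_gt1 hp, prime_gt1 hq).
have pX_gt0 e : (0 < p ^ e)%N by rewrite expn_gt0 ltnW.
have qX_gt0 e : (0 < q ^ e)%N by rewrite expn_gt0 ltnW.
have co_pq : coprime p q by rewrite prime_coprime // dvdn_prime2 //; apply/eqP.
have co_pl : coprime p l by rewrite prime_coprime // dvdn_prime2 //; apply/eqP.
have co_ql : coprime q l by rewrite prime_coprime // dvdn_prime2 //; apply/eqP.
have co_pqX e f : coprime (p ^ e) (q ^ f) by rewrite coprimeXl ?coprimeXr.
pose n := (p ^ s * q ^ t)%N.
have n_gt0 : (0 < n)%N by rewrite muln_gt0 pX_gt0 qX_gt0.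
have n_gt1 : (1 < n)%N.
  apply: leq_trans (leq_pmulr _ (qX_gt0 t)).
  by rewrite -[X in (X < _)%N](exp1n s) ltn_exp2r.
have co_nl : coprime n l by rewrite coprimeMl !coprimeXl.
have tot_even e : (0 < e)%N -> totient (p ^ e) = (totient (p ^ e) %/ 2 * 2)%N.
  by move=> e_gt0; rewrite divnK // totient_pfactor // dvdn_mulr //; lia.
(* Here [p = 3] modulo 4 makes [(p - 1) / 2] odd. *)
have odd_half : odd (totient (p ^ s) %/ 2).
  have -> : (totient (p ^ s) %/ 2 = p.-1 %/ 2 * p ^ s.-1)%N.
    by rewrite totient_pfactor // divn_mulAC //; lia.
  by rewrite oddM oddX p_odd orbT andbT; lia.
(* A common divisor of these two divides the gcd 2 of the totients, and the first one is odd. *)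
have co_ord : coprime (totient (p ^ s) %/ 2) (totient (q ^ t)).
  have: coprime (totient (p ^ s) %/ 2) 2 by rewrite coprimen2.
  have /gcdn_idPl half : (totient (p ^ s) %/ 2 %| totient (p ^ s))%N.
    by rewrite [X in (_ %| X)%N]tot_even // dvdn_mulr.
  by rewrite /coprime -[X in gcdn _ X == _ -> _]hgcd gcdnA half.
(* Used at [(s, t)] for the index 2 and at [(s - i', t - j')] for the size of the second coset;
   [i' <= s - 1] provides [0 < e] in the latter case. *)
have ord_mod e f : (0 < e <= s)%N -> (f <= t)%N ->
    mulord (p ^ e * q ^ f) l = (totient (p ^ e) %/ 2 * totient (q ^ f))%N.
  move=> e_le f_le.
  have ep := mulord_pfactor_half hp co_pl e_le hp4 hordp.
  have eq := mulord_pfactor_totient hq co_ql f_le hordq.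
  have co_low : coprime (totient (p ^ e) %/ 2) (totient (q ^ f)).
    case/andP: e_le => e_gt0 e_le.
    apply: coprime_dvdl (coprime_dvdr _ co_ord).
      rewrite -(dvdn_pmul2r (isT : (0 < 2)%N)) -!tot_even // !totient_pfactor //.
      by apply: dvdn_mul => //; apply: dvdn_exp2l; lia.
    case: f f_le {eq} => [|f] f_le; first by rewrite expn0 dvd1n.
    by rewrite !totient_pfactor //; apply: dvdn_mul => //; apply: dvdn_exp2l; lia.
  by rewrite mulordM ?ep ?eq //; apply: coprimeXl.
have mem_pow y : (y = 1 %[mod p * q])%N -> exists r, (y = l ^ r %[mod n])%N.
  move/eqP; rewrite chinese_remainder // => /andP[/eqP y1p /eqP y1q].
  have co_yp : coprime p y by rewrite -coprime_modr y1p coprime_modr coprimen1.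
  have co_yq : coprime q y by rewrite -coprime_modr y1q coprime_modr coprimen1.
  (* This odd exponent lifts the congruence to 1 from modulus [p] to [p ^ s] and from [q] to
     [q ^ t]. *)
  apply: (@odd_order_mem_powers _ _ _ (p ^ (s - 1) * q ^ (t - 1))) => //.
  - by rewrite coprimeMl !coprimeXl.
  - by rewrite totient_coprime // ord_mod ?hs ?leqnn // mulnAC -tot_even.
  - by rewrite oddM !oddX p_odd q_odd !orbT.
  apply/eqP; rewrite chinese_remainder //; apply/andP; split; apply/eqP.
    rewrite expnM -modnXm -[in (p ^ s)%N](subnKC hs) expn_mod1_pfactor ?expn1 //.
    by rewrite modnXm exp1n.
  rewrite mulnC expnM -modnXm -[in (q ^ t)%N](subnKC ht) expn_mod1_pfactor ?expn1 //.
  by rewrite modnXm exp1n.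
(* All four identities are instances, with [u] and [v] equal to 1 or to the residue of [g]. *)
have key u v : coprime n u -> coprime n v ->
    coset_sum l (cyclotomic_coset l n (p ^ i * q ^ j * u)%N) *
      coset_sum l (cyclotomic_coset l n (p ^ i' * q ^ j' * v)%N) =
    c *: coset_sum l (cyclotomic_coset l n (p ^ i * q ^ j * u)%N).
  move=> co_u co_v; set A := cyclotomic_coset l n _; set B := cyclotomic_coset l n _.
  have cardB : #|B| = (totient (p ^ (s - i')) %/ 2 * totient (q ^ (t - j')))%N.
    have nE : n = (p ^ i' * q ^ j' * (p ^ (s - i') * q ^ (t - j')))%N.
      rewrite mulnACA -!expnD !subnKC //; lia.
    rewrite -ord_mod ?leq_subr //; last by lia.
    apply: (card_cyclotomic_coset nE).
    - by rewrite muln_gt0 pX_gt0 qX_gt0.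
    - by rewrite muln_gt0 pX_gt0 qX_gt0.
    - by rewrite coprimeMl !coprimeXl.
    by move: co_v; rewrite {1}nE coprimeMl => /andP[].
  rewrite /c -cardB; apply: coset_sum_translate.
  have expnE (x k k' : nat) : (k < k')%N -> (x ^ k' = x * x ^ k * x ^ (k' - k).-1)%N.
    by move=> lt_k; rewrite -expnS -expnD; congr (_ ^ _)%N; lia.
  (* The strict inequalities [i < i'] and [j < j'] leave a spare factor [p * q], the [e] of the
     translation lemma. *)
  have BE : (p ^ i' * q ^ j' * v = p * q * (p ^ i * q ^ j) *
      (p ^ (i' - i).-1 * q ^ (j' - j).-1 * v))%N.
    by rewrite (expnE p _ _ hii') (expnE q _ _ hjj'); lia.
  move=> a b x aA; rewrite /B BE => bB.
  exact: (cyclotomic_coset_translate n_gt0 co_nl co_u mem_pow aA bB).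
(* The integer [g] may be negative, so its residue modulo [n] serves as the natural number required
   by [key]. *)
have co_ng : coprime n `|(g %% n)%Z|.
  have: coprimez n (g %% n)%Z.
    rewrite /coprimez gcdz_modr -/(coprimez n g) coprimezE coprimeMl.
    have := mulord_gt0_coprimez (_ : (0 < mulord (p ^ s) g)%N).
    have := mulord_gt0_coprimez (_ : (0 < mulord (q ^ t) g)%N).
    by rewrite hgp hgq !totient_gt0 !coprimezE => -> // ->.
  by rewrite coprimezE.
have XE e f : X e f = coset_sum l (cyclotomic_coset l n (p ^ e * q ^ f * 1)%N).
  by rewrite muln1.
have XsE e f : X_star e f =
    coset_sum l (cyclotomic_coset l n (p ^ e * q ^ f * `|(g %% n)%Z|)%N).
  congr coset_sum; apply: cyclotomic_coset_modz.
  rewrite [in RHS]PoszM gez0_abs ?modz_ge0 ?modzMmr //.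
  by apply/eqP => -[] ; lia.
by rewrite !XE !XsE; split; split; apply: key; rewrite // coprimen1.
Qed.
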